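(* For every $(\xi,\zeta)\in D^{J+K}$ (with $\xi\in D^J$, $\zeta\in D^K$) satisfying $\sum_{j=1}^J\xi_j(t)+\sum_{k=1}^K\zeta_k(t)=0$ for all $t\ge0$ and $\xi_j(0)\ge0$ for all $j\in[J]$, there exists a unique $(x,u,y)\in D^{2J+K}$ (with $x,u\in D^J$, $y\in D^K$) such that for all $j\in[J]$, $k\in[K]$, $t\ge0$: $$x_j(t)=\xi_j(t)+\sum_{k=1}^Kq_{kj}\eta_k\int_0^ty_k(s)\,ds+\mu_ju_j(t)\ge0,$$ $$y_k(t)=\zeta_k(t)-\eta_k\int_0^ty_k(s)\,ds-\sum_{j=1}^Jp_{jk}\mu_ju_j(t),$$ $$\sum_{j=1}^Jx_j(t)+\sum_{k=1}^Ky_k(t)=0,$$ $$u_j\text{ is nondecreasing with }u_j(0)=0,$$ $$\int_0^\infty\mathbf{1}_{\{x_j(t)>0\}}\,du_j(t)=0.$$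
   Context: $[k]=\{1,\dots,k\}$. $D^k$ is the set of functions $[0,\infty)\to\mathbb{R}^k$ that are right continuous on $[0,\infty)$ with left limits on $(0,\infty)$. Fixed data: $J,K\in\mathbb{N}$, $\mu_j>0$ for $j\in[J]$, $\eta_k>0$ for $k\in[K]$, and stochastic matrices $(p_{jk})\in\mathbb{R}^{J\times K}$, $(q_{kj})\in\mathbb{R}^{K\times J}$ (nonnegative entries, each row summing to $1$). *)

(* Defs.v *)
From mathcomp Require Import all_boot all_order all_algebra.
From mathcomp Require Import all_classical all_reals all_analysis.

Set Implicit Arguments.
Unset Strict Implicit.
Unset Printing Implicit Defensive.

Import Order.TTheory GRing.Theory Num.Theory.
Import numFieldNormedType.Exports.

Local Open Scope classical_set_scope.
Local Open Scope ring_scope.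

(* A path [0, oo) -> R^k is encoded as a total function R -> 'rV[R]_k whose
   values at negative times are irrelevant: every predicate below only looks at
   times t >= 0 (the one-sided filters t^'+ for t >= 0 and t^'- for t > 0 only
   see nonnegative times), and two paths are identified when they agree on
   [0, oo). *)
Definition cadlag (R : realType) (k : nat) (f : R -> 'rV[R]_k) : Prop :=
  (forall t : R, 0 <= t -> f s @[s --> t^'+] --> f t) /\
  (forall t : R, 0 < t -> cvg (f s @[s --> t^'-])).

Definition eq_on_halfline (R : realType) (k : nat) (f g : R -> 'rV[R]_k) : Prop :=
  forall t : R, 0 <= t -> f t = g t.

Definition stochastic (R : realType) (m n : nat) (A : 'M[R]_(m, n)) : Prop :=
  (forall i j, 0 <= A i j) /\ (forall i, \sum_(j < n) A i j = 1).

(* The Lebesgue-Stieltjes measure du exists and the integral of h du over [0, oo) is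
   equal to c.  Library Stieltjes measures come from nondecreasing
   right-continuous functions on the whole line, so u is extended by the
   constant u 0 to negative times; in particular du has no atom at 0, which is
   the usual convention for u 0 = 0.  The function U is determined by u. *)
Definition stieltjes_integral_eq (R : realType) (u h : R -> R) (c : \bar R)
    : Prop :=
  exists U : cumulative R R,
    (forall t : R, U t = u (Num.max 0 t)) /\
    (\int[lebesgue_stieltjes_measure U]_(t in `[0%R, +oo[) (h t)%:E)%E = c.

Definition solution (R : realType) (J K : nat)
    (mu : 'I_J -> R) (eta : 'I_K -> R)
    (p : 'M[R]_(J, K)) (q : 'M[R]_(K, J))
    (xi : R -> 'rV[R]_J) (zeta : R -> 'rV[R]_K)
    (x u : R -> 'rV[R]_J) (y : R -> 'rV[R]_K) : Prop :=
  [/\ cadlag x, cadlag u & cadlag y] /\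
  [/\ forall (j : 'I_J) (t : R), 0 <= t ->
        x t 0 j = xi t 0 j
          + \sum_(k < K) q k j * eta k *
              (\int[lebesgue_measure]_(s in `[0, t]) y s 0 k)
          + mu j * u t 0 j
        /\ 0 <= x t 0 j,
      forall (k : 'I_K) (t : R), 0 <= t ->
        y t 0 k = zeta t 0 k
          - eta k * (\int[lebesgue_measure]_(s in `[0, t]) y s 0 k)
          - \sum_(j < J) p j k * mu j * u t 0 j,
      forall t : R, 0 <= t ->
        \sum_(j < J) x t 0 j + \sum_(k < K) y t 0 k = 0,
      forall j : 'I_J,
        (forall s t : R, 0 <= s -> s <= t -> u s 0 j <= u t 0 j) /\
        u 0 0 j = 0
    & forall j : 'I_J,
        stieltjes_integral_eq (fun t => u t 0 j)
          (\1_[set t | 0 < x t 0 j]) 0%E].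

(* Main.v *)
From HB Require Import structures.
Require Import Defs.
From mathcomp Require Import all_boot all_order all_algebra.
From mathcomp Require Import all_classical all_reals all_analysis.
From mathcomp Require Import measurable_realfun.
From mathcomp Require Import ring lra.

Set Implicit Arguments.
Unset Strict Implicit.
Unset Printing Implicit Defensive.

Import Order.TTheory GRing.Theory Num.Theory.
Import numFieldNormedType.Exports.

Local Open Scope classical_set_scope.
Local Open Scope ring_scope.

(** In units of [mu_j], the equations for [x_j] and [u_j] say that [u_j] pushes
    the free path
      [mu_j X_j(t) = xi_j(t) + sum_k q_kj eta_k (integral of y_k over [0, t])]
    up by the least amount that keeps it nonnegative.  This is the
    one-dimensional Skorokhod problem, solved by
      [u_j(t) = reg X_j t = sup of 0 and of the - X_j(s) for 0 <= s <= t].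
    That this [u_j] grows only when [x_j = 0] is [reg_complementarity]; that no
    other admissible [u_j] does so is [reg_unique].

    Substituting [u_j = reg X_j] into the equation for [y] leaves the single
    equation [y = feedback y], in which [y] occurs on the right only through its
    time integrals.  As [X |-> reg X] is 1-Lipschitz for the supremum over
    [[0, t]] ([reg_lipschitz]), [feedback] is Lipschitz in these integrals.
    Integration gains a factor [1 / lam] in the norm weighted by
    [exp (- lam t)] ([primitive_close]), so for [lam] large [feedback] is a
    contraction with factor [1 / 2] on every bounded time interval
    ([feedback_contraction]).  Picard iteration then gives existence
    ([fixed_point_exists]), and the same estimate gives uniqueness
    ([fixed_point_unique]).  The contraction is carried out on locally bounded
    measurable paths, a class stable under locally uniform limits; the solution
    is right continuous with left limits because the values of [feedback] are.

    The constraint [sum_j x_j + sum_k y_k = 0] is a consequence of the other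
    equations, since it holds for [xi] and [zeta] and the rows of [p] and [q]
    sum to [1] ([balance]). *)

(** * Right-continuous functions with left limits *)

(** Right continuity with left limits on the half-line, for a single coordinate
    of a path. *)
Definition rcll (R : realType) (f : R -> R) : Prop :=
  (forall t : R, 0 <= t -> f s @[s --> t^'+] --> f t) /\
  (forall t : R, 0 < t -> cvg (f s @[s --> t^'-])).

Definition locally_bounded (R : realType) (f : R -> R) : Prop :=
  forall T : R, exists M : R, forall t, 0 <= t <= T -> `|f t| <= M.

Lemma rcll_cst (R : realType) (c : R) : rcll (fun=> c).
Proof. by split=> t _; [exact: cvg_cst | exact: is_cvg_cst]. Qed.

Lemma rcllD (R : realType) (f g : R -> R) :
  rcll f -> rcll g -> rcll (fun t => f t + g t).
Proof.
move=> [fr fl] [gr gl]; split=> t t0.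
  by apply: cvgD; [exact: fr | exact: gr].
by apply: is_cvgD; [exact: fl | exact: gl].
Qed.

Lemma rcllM (R : realType) (f g : R -> R) :
  rcll f -> rcll g -> rcll (fun t => f t * g t).
Proof.
move=> [fr fl] [gr gl]; split=> t t0.
  by apply: cvgM; [exact: fr | exact: gr].
by apply: is_cvgM; [exact: fl | exact: gl].
Qed.

Lemma rcllZ (R : realType) (c : R) (f : R -> R) :
  rcll f -> rcll (fun t => c * f t).
Proof. by apply: rcllM; exact: rcll_cst. Qed.

Lemma rcllB (R : realType) (f g : R -> R) :
  rcll f -> rcll g -> rcll (fun t => f t - g t).
Proof.
move=> fr gr; have -> : (fun t => f t - g t) = (fun t => f t + -1 * g t).
  by apply/funext => t; rewrite mulN1r.
by apply: rcllD => //; exact: rcllZ.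
Qed.

Lemma rcll_sum (R : realType) (I : finType) (f : I -> R -> R) :
  (forall i, rcll (f i)) -> rcll (fun t => \sum_i f i t).
Proof.
move=> fr; elim: (index_enum I) => [|i s IHs].
  by under eq_fun do rewrite big_nil; exact: rcll_cst.
by under eq_fun do rewrite big_cons; exact: rcllD.
Qed.

Lemma rcll_eps (R : realType) (f : R -> R) (t e : R) : rcll f -> 0 <= t ->
  0 < e -> exists2 d, 0 < d & forall s, t <= s < t + d -> `|f s - f t| < e.
Proof.
move=> [fr _] t0 e0; have /cvgrPdist_lt /(_ _ e0) := fr t t0.
case=> d /= d0 fd; exists d => // s /andP[]; rewrite le_eqVlt.
case/orP=> [/eqP <- _|ts std]; first by rewrite subrr normr0.
rewrite distrC; apply: fd => //=.
by rewrite distrC gtr0_norm ?subr_gt0// ltrBlDl.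
Qed.

Lemma rcll_eq (R : realType) (f g : R -> R) :
  (forall t, 0 <= t -> f t = g t) -> rcll f -> rcll g.
Proof.
move=> fg [fr fl]; split=> t t0.
  rewrite -fg//; apply: cvg_trans (fr t t0); apply: near_eq_cvg.
  by near=> s; apply: fg; rewrite (le_trans t0).
have /cvg_ex[l fsl] := fl t t0; apply/cvg_ex; exists l.
apply: cvg_trans fsl; apply: near_eq_cvg.
near=> s; apply: fg; near: s; exact: nbhs_left_ge.
Unshelve. all: end_near. Qed.

(** The one-sided limits bound [f] near each time, and [[0, T]] is compact. *)
Lemma rcll_locally_bounded (R : realType) (f : R -> R) :
  rcll f -> locally_bounded f.
Proof.
move=> [fr fl] T.
have near1 (l a : R) : `|l - a| <= 1 -> `|a| <= `|l| + 1.
  by move=> la; have := ler_normB l (l - a); rewrite subKr; lra.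
have /compact_near_coveringP cov := @segment_compact R 0 T.
have [|M [_ HM]] := cov R (+oo : set_system R)
    (fun M t => 0 <= t -> `|f t| <= M) _.
  move=> /= x /[!in_itv]/= /andP[x0 xT].
  have [Mr Mrx] : exists M, \forall s \near x^'+, `|f s| <= M.
    exists (`|f x| + 1).
    have /cvgrPdist_le H := fr x x0.
    by have := H 1 ltr01; apply: filterS => s; exact: near1.
  have [Ml Mlx] : exists M, \forall s \near x^'-, 0 <= s -> `|f s| <= M.
    move: x0; rewrite le_eqVlt => /orP[/eqP <-|x0].
      exists 0; near=> s => s0; exfalso.
      suff : s < 0 by rewrite ltNge s0.
      by near: s; exact: nbhs_left_lt.
    have /cvg_ex[l fxl] := fl x x0.
    exists (`|l| + 1); move/cvgrPdist_le : fxl => H.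
    by have := H 1 ltr01; apply: filterS => s /near1.
  have Mx : \forall s \near x, 0 <= s -> `|f s| <= `|f x| + `|Ml| + `|Mr|.
    move: Mrx Mlx => [d1 /= d10 H1] [d2 /= d20 H2].
    near=> s => s0; have [sx|xs|->] := ltgtP s x.
    - have fs : `|f s| <= Ml by apply: H2 => //; near: s; exact: nbhsx_ballx.
      have := normr_ge0 (f x); have := ler_norm Ml; have := normr_ge0 Mr; lra.
    - have fs : `|f s| <= Mr by apply: H1 => //; near: s; exact: nbhsx_ballx.
      have := normr_ge0 (f x); have := ler_norm Mr; have := normr_ge0 Ml; lra.
    - by rewrite -addrA lerDl addr_ge0.
  exists ([set s | 0 <= s -> `|f s| <= `|f x| + `|Ml| + `|Mr|],
    [set M | `|f x| + `|Ml| + `|Mr| <= M]) => /=.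
    split=> //; exact: nbhs_pinfty_ge.
  by move=> [s M] /= [+ +] s0 => /(_ s0) fs; exact: le_trans.
exists (M + 1) => t /andP[t0 tT].
by apply: HM; rewrite ?ltrDl//= in_itv/= t0.
Unshelve. all: end_near. Qed.

(** Right continuity makes [f] the pointwise limit of the step functions
    [t |-> f ((floor (n t) + 1) / n)]: the nodes approach [t] from the right. *)
Lemma rcll_measurable (R : realType) (f : R -> R) :
  rcll f -> measurable_fun (`[0, +oo[ : set R) f.
Proof.
move=> rf.
pose node (n : nat) (t : R) : R := ((Num.truncn (n.+1%:R * t)).+1)%:R / n.+1%:R.
apply: (@measurable_fun_cvg _ _ _ _ (fun n t => f (node n t))).
  move=> n.
  have cover : `[0, +oo[%classic =
      \bigcup_k `[k%:R / n.+1%:R : R, k.+1%:R / n.+1%:R[%classic.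
    apply/seteqP; split=> t /=; rewrite ?in_itv/= ?andbT => t0.
      exists (Num.truncn (n.+1%:R * t)) => //=; rewrite in_itv/=.
      rewrite ler_pdivrMr ?ltr_pdivlMr// ![t * _]mulrC.
      by rewrite truncn_itv// mulr_ge0.
    case: t0 => k _ /=; rewrite in_itv/= => /andP[kt _].
    by rewrite (le_trans _ kt)// divr_ge0.
  rewrite cover; apply/measurable_fun_bigcup => //= k.
  apply: (@eq_measurable_fun _ _ _ _ _ (fun=> f (k.+1%:R / n.+1%:R))).
    move=> t; rewrite inE/= in_itv/= => kt; rewrite /node.
    do 4 f_equal; apply/esym/truncn_def.
    by move: kt; rewrite ler_pdivrMr ?ltr_pdivlMr// ![t * _]mulrC.
  exact: measurable_cst.
move=> t /=; rewrite in_itv/= andbT => t0.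
apply/cvgrPdist_lt => e e0.
have [d d0 fd] := rcll_eps rf t0 e0.
near=> n; rewrite distrC; apply: fd.
have nt0 : 0 <= n.+1%:R * t by rewrite mulr_ge0.
have /truncn_itv /andP[k1 k2] := nt0.
rewrite /node ler_pdivlMr// ltr_pdivrMr// ![t * _]mulrC (ltW k2)/=.
have : n.+1%:R^-1 < d.
  by near: n; exact: (near_infty_natSinv_lt (PosNum d0)).
rewrite -div1r ltr_pdivrMr// mulrC => nd.
by rewrite mulrDl ![_ * n.+1%:R]mulrC -[ltLHS]natr1 ler_ltD.
Unshelve. all: end_near. Qed.

(** * The regulator of the Skorokhod problem *)

(** The element [0] turns the supremum of the [- X s] into that of the negative
    parts, and keeps the set nonempty at negative times, so that [reg X] is a
    nondecreasing function on the whole line, as Stieltjes measures require. *)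
Definition reg_values (R : realType) (X : R -> R) (t : R) : set R :=
  [set r | r = 0 \/ exists2 s, 0 <= s <= t & r = - X s].

(** The regulator of the one-dimensional Skorokhod problem: [X + reg X] is the
    path [X] reflected at [0]. *)
Definition reg (R : realType) (X : R -> R) (t : R) : R := sup (reg_values X t).

Section Regulator.
Context {R : realType}.
Implicit Types (X : R -> R) (s t : R).

Lemma reg_le X t c : 0 <= c -> (forall s, 0 <= s <= t -> - X s <= c) ->
  reg X t <= c.
Proof.
move=> c0 Xc; apply: ge_sup; first by exists 0; left.
by move=> r [->//|[s st ->]]; exact: Xc.
Qed.

Lemma eq_reg X Y t : (forall s, 0 <= s <= t -> X s = Y s) -> reg X t = reg Y t.
Proof.
move=> XY; congr sup; apply/seteqP.
split=> r [->|[s st ->]]; first by left.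
- by right; exists s; rewrite ?XY.
- by left.
- by right; exists s; rewrite ?XY.
Qed.

Lemma reg_has_ubound X t : locally_bounded X -> has_ubound (reg_values X t).
Proof.
move=> /(_ t)[M XM]; exists `|M| => r [->//|[s st ->]].
by rewrite (le_trans (ler_norm _))// normrN (le_trans (XM _ st))// ler_norm.
Qed.

Lemma reg_ge X s t : locally_bounded X -> 0 <= s <= t -> - X s <= reg X t.
Proof.
by move=> bX st; apply: ub_le_sup; [exact: reg_has_ubound|right; exists s].
Qed.

Lemma reg_ge0 X t : locally_bounded X -> 0 <= reg X t.
Proof. by move=> bX; apply: ub_le_sup; [exact: reg_has_ubound|left]. Qed.

Lemma reg_nondecreasing X : locally_bounded X -> {homo reg X : s t / s <= t}.
Proof.
move=> bX s t st; apply: reg_le; first exact: reg_ge0.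
move=> r /andP[r0 rs]; apply: reg_ge => //.
by rewrite r0 (le_trans rs).
Qed.

Lemma reg_le0 X t : locally_bounded X -> 0 <= X 0 -> t <= 0 -> reg X t = 0.
Proof.
move=> bX X0 t0; apply/eqP; rewrite eq_le reg_ge0// andbT; apply: reg_le => //.
move=> s /andP[s0 st]; have -> : s = 0 by lra.
by rewrite oppr_le0.
Qed.

(** Replaces the supremum by a witness: as [c >= 0], the adjoined element [0]
    cannot be the one above [c]. *)
Lemma reg_gt X t c : locally_bounded X -> 0 <= c -> c < reg X t ->
  exists2 s, 0 <= s <= t & c < - X s.
Proof.
move=> bX c0 ct; apply: contrapT => /forall2NP nX.
move: ct; apply/negP; rewrite -leNgt; apply: reg_le => // s st.
by have [//|/negP] := nX s; rewrite -leNgt.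
Qed.

Lemma reg_lipschitz X Y t e : locally_bounded X -> locally_bounded Y ->
  0 <= e -> (forall s, 0 <= s <= t -> `|X s - Y s| <= e) ->
  `|reg X t - reg Y t| <= e.
Proof.
move=> bX bY e0 XY.
have half (X1 X2 : R -> R) : locally_bounded X1 -> locally_bounded X2 ->
    (forall s, 0 <= s <= t -> `|X1 s - X2 s| <= e) ->
    reg X1 t <= reg X2 t + e.
  move=> b1 b2 H; apply: reg_le; first by rewrite addr_ge0// reg_ge0.
  move=> s st; have := H s st; have := reg_ge b2 st; rewrite ler_norml; lra.
have H1 := half _ _ bX bY XY.
have H2 : reg Y t <= reg X t + e by apply: half => // s st; rewrite distrC XY.
rewrite ler_norml; lra.
Qed.

(** Right after [t] the path stays close to [X t], so it cannot set a record
    much above [reg X t]. *)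
Lemma reg_right_continuous X t : rcll X -> 0 <= X 0 ->
  reg X s @[s --> t^'+] --> reg X t.
Proof.
move=> rX X0; have bX := rcll_locally_bounded rX.
apply/cvgrPdist_le => e e0.
have [d d0 rd] : exists2 d, 0 < d &
    forall s, t <= s < t + d -> reg X s <= reg X t + e.
  have [t0|t0] := ltP t 0.
    exists (- t); first by rewrite oppr_gt0.
    move=> s; rewrite subrr => /andP[_ s0].
    by rewrite !reg_le0 ?(ltW s0) ?(ltW t0)// add0r ltW.
  have [d d0 Xd] := rcll_eps rX t0 e0; exists d => // s /andP[ts std].
  apply: reg_le; first by rewrite addr_ge0 ?reg_ge0// ltW.
  move=> r /andP[r0 rs]; have [rt|tr] := leP r t.
    have : - X r <= reg X t by apply: reg_ge => //; rewrite r0.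
    lra.
  have : `|X r - X t| < e by apply: Xd; rewrite (ltW tr) (le_lt_trans rs).
  have : - X t <= reg X t by apply: reg_ge => //; rewrite t0 lexx.
  rewrite ltr_norml; lra.
near=> s; rewrite distrC ger0_norm.
  rewrite lerBlDl; apply: rd; apply/andP; split.
    by near: s; exact: nbhs_right_ge.
  by near: s; apply: nbhs_right_lt; rewrite ltrDl.
by rewrite subr_ge0 reg_nondecreasing//; near: s; exact: nbhs_right_ge.
Unshelve. all: end_near. Qed.

Lemma reg_rcll X : rcll X -> 0 <= X 0 -> rcll (reg X).
Proof.
move=> rX X0; have bX := rcll_locally_bounded rX.
split=> t t0; first exact: reg_right_continuous.
apply: nondecreasing_at_left_is_cvgr.
  by near=> s => r1 r2 _ _; exact: reg_nondecreasing.
near=> s; exists (reg X t) => _ [r rs <-]; apply: reg_nondecreasing => //.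
by move: rs; rewrite /= in_itv/= => /andP[_ /ltW].
Unshelve. all: end_near. Qed.

End Regulator.

(** * Stieltjes measures and the complementarity condition *)

Section Stieltjes.
Context {R : realType}.
Implicit Types (X v : R -> R) (U : cumulative R R).

(* [negligibleS] at the carrier [R], which unification does not find from the
   type on which the measure is built. *)
Let nullS U (A B : set R) : B `<=` A ->
  (lebesgue_stieltjes_measure U).-negligible A ->
  (lebesgue_stieltjes_measure U).-negligible B.
Proof. exact: (@negligibleS _ _ _ (lebesgue_stieltjes_measure U)). Qed.

Lemma stieltjes_oc U (a b : R) : a <= b ->
  lebesgue_stieltjes_measure U `]a, b]%classic = (U b - U a)%:E.
Proof.
move=> ab; rewrite /lebesgue_stieltjes_measure /measure_extension.
by rewrite measurable_mu_extE/= ?wlength_itv_bnd//; exact: is_ocitv.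
Qed.

Lemma stieltjes_atom_le U (a e : R) :
  (exists2 s, s < a & U a - U s <= e) ->
  (lebesgue_stieltjes_measure U [set a] <= e%:E)%E.
Proof.
move=> [s sa Use].
apply: (@le_trans _ _ (lebesgue_stieltjes_measure U `]s, a]%classic)).
  apply: le_measure; rewrite ?inE.
  - exact: measurable_set1.
  - exact: measurable_itv.
  - by move=> _ -> /=; rewrite in_itv/= sa lexx.
by rewrite stieltjes_oc ?lee_fin// ltW.
Qed.

(** Continuity from above along the intervals [(a - 1 / n, a]]. *)
Lemma stieltjes_atom_ge U (a e : R) :
  (forall s, s < a -> e <= U a - U s) ->
  (e%:E <= lebesgue_stieltjes_measure U [set a])%E.
Proof.
move=> He; pose F n : set R := `]a - n.+1%:R^-1, a]%classic.
have FE n : lebesgue_stieltjes_measure U (F n) = (U a - U (a - n.+1%:R^-1))%:E.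
  by apply: stieltjes_oc; rewrite gerBl invr_ge0.
have cF : lebesgue_stieltjes_measure U \o F @ \oo -->
    lebesgue_stieltjes_measure U (\bigcap_n F n).
  apply: nonincreasing_cvg_mu.
  - by rewrite [ltLHS](FE 0%N) ltry.
  - by move=> n; exact: measurable_itv.
  - by rewrite -set1_bigcap_oc; exact: measurable_set1.
  - move=> m n mn; apply/subsetPset/subset_itv => //.
    by rewrite bnd_simp lerD2l lerN2 lef_pV2 ?posrE// ler_nat.
rewrite set1_bigcap_oc.
rewrite -(cvg_lim _ cF)//; apply: lime_ge.
  by apply/cvg_ex; eexists; exact: cF.
by near=> n; rewrite /comp FE lee_fin He// gtrBl invr_gt0.
Unshelve. all: end_near. Qed.

(** Only the trace of the integrand on the half-line matters, so measurability
    of [x] there is enough to read the integral as the mass of [x > 0]. *)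
Lemma stieltjes_integral_positive U (x : R -> R) :
  measurable_fun (`[0, +oo[ : set R) x ->
  (\int[lebesgue_stieltjes_measure U]_(t in `[0%R, +oo[)
     (\1_[set t | 0 < x t] t)%:E = 0)%E <->
  (lebesgue_stieltjes_measure U).-negligible [set t | 0 <= t /\ 0 < x t].
Proof.
move=> mx; pose D : set R := `[0, +oo[%classic.
have mD : measurable D by exact: measurable_itv.
pose B := D `&` [set t | 0 < x t].
have BE : B = [set t | 0 <= t /\ 0 < x t].
  by apply/seteqP; split=> t; rewrite /B/D/= in_itv/= andbT.
have mB : measurable B.
  have := measurable_fun_ltr (measurable_cst (0 : R)) mx.
  by move=> /(_ mD [set true] I); rewrite preimage_true.
rewrite -BE; have -> : (\int[lebesgue_stieltjes_measure U]_(t in `[0%R, +oo[)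
     (\1_[set t | (0 < x t)%R] t)%:E =
   lebesgue_stieltjes_measure U B)%E.
  transitivity (\int[lebesgue_stieltjes_measure U]_(t in D) (\1_B t)%:E)%E.
    apply: eq_integral => t tD; rewrite !indicE; do 2 f_equal.
    by rewrite /B in_setI tD.
  by rewrite integral_indic// setIC /B setIA setIid.
by split=> /negligibleP; exact.
Qed.

Section Complementarity.
Variables (X : R -> R) (U : cumulative R R).
Hypotheses (rX : rcll X) (X0 : 0 <= X 0) (UX : forall t, U t = reg X t).

Let bX : locally_bounded X := rcll_locally_bounded rX.

(** Where the reflected path is positive, right continuity keeps it positive
    for a while, so the running supremum sets no new record. *)
Let reg_flat (t : R) : 0 <= t -> 0 < X t + reg X t ->
  exists2 d, 0 < d & forall s, t <= s < t + d -> reg X s = reg X t.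
Proof.
move=> t0 xt; have e0 : 0 < (X t + reg X t) / 2 by rewrite divr_gt0.
have [d d0 Xd] := rcll_eps rX t0 e0; exists d => // s /andP[ts std].
apply/eqP; rewrite eq_le (reg_nondecreasing bX ts) andbT.
apply: reg_le; first exact: reg_ge0.
move=> r /andP[r0 rs]; have [rt|tr] := leP r t.
  by apply: reg_ge; rewrite ?r0.
have : `|X r - X t| < (X t + reg X t) / 2.
  by apply: Xd; rewrite (ltW tr) (le_lt_trans rs).
rewrite ltr_norml; lra.
Qed.

(** A jump of the running supremum at [a] would make [a] a strict record, that
    is [- X a = reg X a]. *)
Let reg_no_atom (a : R) : 0 <= a -> 0 < X a + reg X a ->
  lebesgue_stieltjes_measure U [set a] = 0%E.
Proof.
move=> a0 xa; apply/eqP; rewrite eq_le measure_ge0 andbT.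
apply/lee_addgt0Pr => e e0; rewrite add0e; apply: stieltjes_atom_le.
have [ra|ra] := leP (reg X a) 0.
  exists (a - 1); first by rewrite gtrBl.
  rewrite !UX; have := reg_ge0 (a - 1) bX; lra.
have [||s /andP[s0 sa]] := @reg_gt _ X a
    (Num.max 0 (Num.max (reg X a - e) (- X a))) bX.
- by rewrite le_max lexx.
- by rewrite !gt_max ra gtrBl e0/=; lra.
rewrite !gt_max => /and3P[_ es aXs].
exists s; last by rewrite !UX; have := @reg_ge _ X s s bX; rewrite s0 lexx; lra.
by rewrite lt_neqAle sa andbT; apply: contraTneq aXs => ->; rewrite ltxx.
Qed.

(** These points lie in one level set of the running supremum, an interval with
    no mass to the right of its left endpoint [a].  The point [a] itself counts
    only when the reflected path is positive there, and then it is not an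
    atom. *)
Let level_negligible (r : R) : (lebesgue_stieltjes_measure U).-negligible
  [set t | [/\ 0 <= t <= r, 0 < X t + reg X t & reg X t = reg X r]].
Proof.
set F := (X in _.-negligible X).
have [[t1 Ft1]|/set0P/negP/negPn/eqP ->] := pselect (F !=set0); last first.
  exact: negligible_set0.
have lF : has_lbound F by exists 0 => t [/andP[]].
pose a := inf F.
have a0 : 0 <= a.
  by apply: lb_le_inf; [exists t1 | move=> t [/andP[]]].
have at1 : a <= t1 by exact: ge_inf.
have ar : reg X a = reg X r.
  apply/eqP; rewrite -subr_eq0 -normr_eq0; apply/negPn/negP => ne.
  have e0 : 0 < `|reg X a - reg X r| by rewrite lt_neqAle eq_sym ne/=.
  have [d d0 Hd] := rcll_eps (reg_rcll rX X0) a0 e0.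
  have [|t Ft tad] := @inf_adherent _ F d d0; first by split=> //; exists t1.
  have := Hd t; rewrite ge_inf//= => /(_ tad).
  by case: Ft => _ _ ->; rewrite distrC ltxx.
have Fsub : F `<=` `]a, r]%classic `|` (F `&` [set a]).
  move=> t Ft; have := ge_inf lF Ft; rewrite le_eqVlt => /orP[/eqP aE|at_].
    by right; split => //=; rewrite -aE.
  by left; rewrite /= in_itv/= at_; case: Ft => /andP[].
apply: (nullS Fsub).
apply: negligibleU.
  apply/negligibleP; first exact: measurable_itv.
  rewrite [LHS]stieltjes_oc; first by rewrite !UX ar subrr.
  by rewrite (le_trans at1)//; case: Ft1 => /andP[].
have [[_ xa _]|nFa] := pselect (F a).
  apply: (@nullS _ [set a]); first by move=> t [].
  by apply/negligibleP; [exact: measurable_set1 | exact: reg_no_atom].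
apply: (@nullS _ set0); last exact: negligible_set0.
by move=> t [Ft ta]; apply: nFa; rewrite -ta.
Qed.

(** The set [x > 0] may be an uncountable union of flat stretches, but each of
    them contains a rational, and the stretches through a given rational are
    treated together by [level_negligible]. *)
Lemma reg_complementarity : (lebesgue_stieltjes_measure U).-negligible
  [set t | 0 <= t /\ 0 < X t + reg X t].
Proof.
pose q (n : nat) : R := ratr (odflt 0 (unpickle n)).
pose F (n : nat) := [set t : R |
  [/\ 0 <= t <= q n, 0 < X t + reg X t & reg X t = reg X (q n)]].
apply: (@nullS _ (\bigcup_n F n)).
  move=> t [t0 xt]; have [d d0 Hd] := reg_flat t0 xt.
  have /rat_in_itvoo[r] : t < t + d by rewrite ltrDl.
  rewrite in_itv/= => /andP[tr rd]; exists (pickle r) => //.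
  have qr : q (pickle r) = ratr r by rewrite /q pickleK.
  split=> //; rewrite qr; first by rewrite t0 ltW.
  by rewrite Hd// (ltW tr).
by apply: negligible_bigcup => n; exact: level_negligible.
Qed.

End Complementarity.

(** Suppose [v] exceeds the running supremum at [t0], and let [tau] be the
    supremum of the times at which [v] is at most [c = reg X t0].  After [tau]
    the reflected path is positive, yet [dv] has mass there: on [(tau, t0]] if
    [v tau <= c], and at [tau] itself if [v] jumps over the level [c]. *)
Lemma reg_unique X v U : rcll X -> 0 <= X 0 ->
  (forall t, 0 <= t -> 0 <= X t + v t) ->
  (forall s t, 0 <= s -> s <= t -> v s <= v t) -> v 0 = 0 ->
  (forall t, U t = v (Num.max 0 t)) ->
  (lebesgue_stieltjes_measure U).-negligible
    [set t | 0 <= t /\ 0 < X t + v t] ->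
  forall t, 0 <= t -> v t = reg X t.
Proof.
move=> rX X0 Xv ndv v0 Uv null t0 t0_ge0.
have bX := rcll_locally_bounded rX.
have UvE t : 0 <= t -> U t = v t by move=> t_ge0; rewrite Uv max_r.
apply/eqP; rewrite eq_le; apply/andP; split; last first.
  apply: reg_le; first by rewrite -v0 ndv.
  by move=> s /andP[s0 st]; have := Xv _ s0; have := ndv _ _ s0 st; lra.
rewrite leNgt; apply/negP => ltv; set c := reg X t0 in ltv.
have Xc s : 0 <= s <= t0 -> - X s <= c by exact: reg_ge.
pose E := [set s | 0 <= s <= t0 /\ v s <= c].
have E0 : E 0 by split; rewrite ?lexx// v0 reg_ge0.
have uE : has_ubound E by exists t0 => s [/andP[]].
pose tau := sup E.
have tau_ge0 : 0 <= tau by exact: ub_le_sup.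
have tau_le : tau <= t0 by apply: ge_sup; [exists 0 | move=> s [/andP[]]].
have above s : tau < s -> s <= t0 -> c < v s.
  move=> ts st0; rewrite ltNge; apply/negP => vs.
  suff : s <= tau by rewrite leNgt ts.
  apply: ub_le_sup => //; split=> //; rewrite st0 andbT.
  by rewrite (le_trans tau_ge0)// ltW.
have pos s : 0 <= s -> s <= t0 -> c < v s -> 0 < X s + v s.
  by move=> s0 st cs; have := Xc s; rewrite s0 st => /(_ isT); lra.
have [vtau|vtau] := leP (v tau) c.
  have : (lebesgue_stieltjes_measure U `]tau, t0]%classic = 0)%E.
    apply/negligibleP; first exact: measurable_itv.
    apply: nullS null => s; rewrite /= in_itv/= => /andP[ts st].
    have s0 : 0 <= s by rewrite (le_trans tau_ge0)// ltW.
    by split=> //; apply: pos => //; exact: above.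
  by rewrite stieltjes_oc// !UvE// => -[]; lra.
have : (lebesgue_stieltjes_measure U [set tau] = 0)%E.
  apply/negligibleP; first exact: measurable_set1.
  by apply: nullS null => _ ->; split=> //; exact: pos.
have : ((v tau - c)%:E <= lebesgue_stieltjes_measure U [set tau])%E.
  apply: stieltjes_atom_ge => s st; rewrite (UvE tau)// lerD2l lerN2 Uv.
  have ts : 0 < tau - s by rewrite subr_gt0.
  have [|r [/andP[r0 rt] vr] sr] := @sup_adherent _ E _ ts.
    by split=> //; exists 0.
  rewrite (le_trans _ vr)// ndv// ?le_max ?lexx// ge_max r0/=.
  by move: sr; rewrite -/tau; lra.
by move=> /[swap] ->; rewrite lee_fin; lra.
Qed.

End Stieltjes.

(** * Fixed points of weighted contractions *)

Lemma geometric_bound_eq0 (R : realType) (a B : R) :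
  (forall n, `|a| <= B / 2 ^+ n) -> a = 0.
Proof.
move=> aB; apply/eqP; rewrite -normr_le0.
have cB : B / 2 ^+ n @[n --> \oo] --> (0 : R).
  under eq_fun do rewrite -exprVn.
  by apply: cvg_geometric; rewrite ger0_norm; lra.
rewrite -(cvg_lim _ cB)//; apply: limr_ge; first by apply/cvg_ex; exists 0.
by near=> n; exact: aB.
Unshelve. all: end_near. Qed.

(** The intervals of radius [2 B / 2 ^ n] around [a n] are nested, and their
    common point is the limit. *)
Lemma geometric_steps_cvg (R : realType) (a : nat -> R) (B : R) :
  (forall n, `|a n.+1 - a n| <= B / 2 ^+ n) ->
  (a n @[n --> \oo] --> limn a) /\
  forall n, `|a n - limn a| <= (2 * B) / 2 ^+ n.
Proof.
move=> step; pose e n := (2 * B) / 2 ^+ n.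
have eS n : e n = 2 * e n.+1.
  by rewrite /e exprS invfM; field; rewrite expf_neq0.
have estep n : B / 2 ^+ n = e n.+1.
  by rewrite /e exprS invfM; field; rewrite expf_neq0.
have e_ge0 n : 0 <= e n.
  have := step n; rewrite estep (eS n).
  by have := normr_ge0 (a n.+1 - a n); lra.
have nest : forall m n, (m <= n)%N ->
    a m - e m <= a n - e n /\ a n + e n <= a m + e m.
  move=> m n /subnK <-; elim: (n - m)%N => [//|k [IH1 IH2]].
  have := step (k + m)%N; rewrite addSn estep ler_norml.
  by have := eS (k + m)%N; split; lra.
pose l := sup (range (fun n => a n - e n)).
have aubd m n : a m - e m <= a n + e n.
  have [mn|/ltnW nm] := leqP m n.
    by have [] := nest _ _ mn; have := e_ge0 n; lra.
  by have [] := nest _ _ nm; have := e_ge0 m; lra.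
have al n : `|a n - l| <= e n.
  have l1 : a n - e n <= l.
    apply: ub_le_sup; last by exists n.
    by exists (a n + e n) => _ [m _ <-].
  have l2 : l <= a n + e n.
    by apply: ge_sup; [exists (a 0%N - e 0%N), 0%N | move=> _ [m _ <-]].
  by rewrite ler_norml; lra.
have cl : a n @[n --> \oo] --> l.
  have ce : e n @[n --> \oo] --> (0 : R).
    rewrite /e; under eq_fun do rewrite -exprVn.
    by apply: cvg_geometric; rewrite ger0_norm; lra.
  apply/cvgrPdist_le => d d0; move/cvgrPdist_le : ce => /(_ _ d0).
  apply: filterS => n; rewrite sub0r normrN ger0_norm// distrC.
  exact: le_trans.
by have -> : limn a = l by exact: cvg_lim.
Qed.

(** The locally bounded measurable paths: they have time integrals, and the
    class is stable under locally uniform limits. *)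
Definition lbm (R : realType) (f : R -> R) : Prop :=
  measurable_fun (`[0, +oo[ : set R) f /\ locally_bounded f.

Lemma rcll_lbm (R : realType) (f : R -> R) : rcll f -> lbm f.
Proof.
by move=> rf; split; [exact: rcll_measurable | exact: rcll_locally_bounded].
Qed.

(** The weighted distance [sup_(k, t <= T) exp (- lam t) |y k t - z k t|] is at
    most [A]. *)
Definition close (R : realType) (I : finType) (lam T A : R)
    (y z : I -> R -> R) : Prop :=
  forall k t, 0 <= t <= T -> `|y k t - z k t| <= A * expR (lam * t).

Section FixedPoint.
Variables (R : realType) (I : finType) (lam : R).
Variable Phi : (I -> R -> R) -> I -> R -> R.
Hypothesis lam_ge0 : 0 <= lam.
Hypothesis Phi_lbm : forall y, (forall k, lbm (y k)) -> forall k, lbm (Phi y k).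
Hypothesis Phi_contraction : forall y z,
  (forall k, lbm (y k)) -> (forall k, lbm (z k)) ->
  forall T A, 0 <= A -> close lam T A y z ->
  close lam T (A / 2) (Phi y) (Phi z).

Let initially_close (y z : I -> R -> R) T :
  (forall k, lbm (y k)) -> (forall k, lbm (z k)) ->
  exists2 A, 0 <= A & close lam T A y z.
Proof.
move=> ly lz.
have /choice[M HM] : forall k, exists M, forall t, 0 <= t <= T ->
    `|y k t - z k t| <= M.
  move=> k; have [_ /(_ T)[M1 H1]] := ly k; have [_ /(_ T)[M2 H2]] := lz k.
  exists (M1 + M2) => t tT; rewrite (le_trans (ler_normB _ _))//.
  by rewrite lerD ?H1 ?H2.
exists (\sum_k `|M k|) => [|k t tT]; first exact: sumr_ge0.
have AM : `|y k t - z k t| <= \sum_k `|M k|.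
  rewrite (le_trans (HM k t tT))// (le_trans (ler_norm _))//.
  by rewrite (bigD1 k)//= lerDl sumr_ge0.
rewrite (le_trans AM)// ler_peMr ?sumr_ge0// -expR0 ler_expR mulr_ge0//.
by case/andP: tT.
Qed.

(** Two fixed points at distance [A] are at distance [A / 2], hence [A / 2 ^ n]
    for every [n]. *)
Lemma fixed_point_unique (y z : I -> R -> R) :
  (forall k, lbm (y k)) -> (forall k, lbm (z k)) ->
  (forall k t, 0 <= t -> y k t = Phi y k t) ->
  (forall k t, 0 <= t -> z k t = Phi z k t) ->
  forall k t, 0 <= t -> y k t = z k t.
Proof.
move=> ly lz yE zE k t t0.
have [A A0 yz] := initially_close t ly lz.
have yzn n : close lam t (A / 2 ^+ n) y z.
  elim: n => [|n IHn]; first by rewrite expr0 divr1.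
  have An0 : 0 <= A / 2 ^+ n by rewrite divr_ge0// exprn_ge0.
  move=> j s st; have s0 : 0 <= s by case/andP: st.
  rewrite yE// zE//; have := Phi_contraction ly lz An0 IHn j st.
  by rewrite exprSr invfM mulrA.
apply/eqP; rewrite -subr_eq0; apply/eqP.
apply: (@geometric_bound_eq0 _ _ (A * expR (lam * t))) => n.
by have := yzn n k t; rewrite t0 lexx mulrAC; apply.
Qed.

(** Picard iteration from [0].  The limit is taken separately at each time: the
    geometric bounds on every [[0, T]] replace completeness of a space of
    paths. *)
Lemma fixed_point_exists : exists2 y : I -> R -> R,
  (forall k, lbm (y k)) & forall k t, 0 <= t -> y k t = Phi y k t.
Proof.
pose y_ n := iter n Phi (fun _ _ => 0).
have ly_ n k : lbm (y_ n k).
  by elim: n k => [k|n IHn k]; [exact/rcll_lbm/rcll_cst | exact: Phi_lbm].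
have step T : exists2 A, 0 <= A &
    forall n, close lam T (A / 2 ^+ n) (y_ n) (y_ n.+1).
  have [A A0 yA] := initially_close T (ly_ 0%N) (ly_ 1%N).
  exists A => //; elim=> [|n IHn]; first by rewrite expr0 divr1.
  have An0 : 0 <= A / 2 ^+ n by rewrite divr_ge0// exprn_ge0.
  have := Phi_contraction (ly_ n) (ly_ n.+1) An0 IHn.
  by rewrite exprSr invfM mulrA.
pose y k t := limn (fun n => y_ n k t).
have lim_y T : exists2 A, 0 <= A & forall k t, 0 <= t <= T ->
    (y_ n k t @[n --> \oo] --> y k t) /\
    forall n, `|y_ n k t - y k t| <= A / 2 ^+ n * expR (lam * t).
  have [A A0 HA] := step T; exists (2 * A) => [|k t tT]; first exact: mulr_ge0.
  have [|yc yb] :=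
    @geometric_steps_cvg R (fun n => y_ n k t) (A * expR (lam * t)).
    by move=> n; have := HA n k t tT; rewrite distrC mulrAC.
  by split=> // n; have := yb n; rewrite mulrA mulrAC.
have ly k : lbm (y k).
  split.
    apply: (@measurable_fun_cvg _ _ _ _ (fun n => y_ n k)).
      by move=> n; case: (ly_ n k).
    move=> t /=; rewrite in_itv/= andbT => t0.
    by have [A _ /(_ k t)] := lim_y t; rewrite t0 lexx => /(_ isT)[].
  move=> T; have [A A0 HA] := lim_y T.
  exists (A * expR (lam * T)) => t tT; have [_ /(_ 0%N)] := HA k t tT.
  rewrite expr0 divr1 /y_/= sub0r normrN => /le_trans -> //.
  by apply: ler_wpM2l => //; rewrite ler_expR ler_wpM2l//; case/andP: tT.
exists y => // k t t0; have [A A0 HA] := lim_y t.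
apply/eqP; rewrite -subr_eq0; apply/eqP.
apply: (@geometric_bound_eq0 _ _ (A * expR (lam * t))) => n.
have tt : 0 <= t <= t by rewrite t0 lexx.
have An0 : 0 <= A / 2 ^+ n by rewrite divr_ge0// exprn_ge0.
have cl : close lam t (A / 2 ^+ n) (y_ n) y.
  by move=> j s st; have [_] := HA j s st; apply.
have H1 := Phi_contraction (ly_ n) ly An0 cl k tt.
have [_ /(_ n.+1) H2] := HA k t tt.
(* Both [y] and [Phi y] are within [O (1 / 2 ^ n)] of the iterate [y_ n.+1]. *)
have -> : y k t - Phi y k t =
    (y_ n.+1 k t - Phi y k t) - (y_ n.+1 k t - y k t) by ring.
rewrite (le_trans (ler_normB _ _))// (le_trans (lerD H1 H2))//.
rewrite exprSr invfM le_eqVlt; apply/orP; left; apply/eqP.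
by field; rewrite expf_neq0.
Qed.

End FixedPoint.

(** * Time integrals, and paths by coordinates *)

Notation primitive f t :=
  (\int[lebesgue_measure]_(s in `[0%R, t]%classic) f s)%R.

Lemma lbm_integrable (R : realType) (f : R -> R) (t : R) : lbm f ->
  (@lebesgue_measure R).-integrable `[0, t] (EFin \o f).
Proof.
move=> [mf bf]; apply: measurable_bounded_integrable.
- exact: measurable_itv.
- by rewrite /= lebesgue_measure_itv/=; case: ifP => _; rewrite -?EFinB ltry.
- apply: measurable_funS mf; first exact: measurable_itv.
  by apply: subset_itvl; rewrite bnd_simp.
- have [M HM] := bf t; exists M; split; first exact: num_real.
  move=> N MN s /=; rewrite in_itv/= => st.
  by rewrite (le_trans (HM s st))// ltW.
Qed.

Lemma primitive_rcll (R : realType) (f : R -> R) : lbm f ->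
  rcll (fun t : R => primitive f t).
Proof.
move=> lf; have cont (t : R) : 0 <= t ->
    [/\ 0 < t -> {for t, continuous (fun t : R => primitive f t)} &
      primitive f s @[s --> 0^'+] --> primitive f 0].
  move=> t0; have t1 : 0 < t + 1 by rewrite ltr_wpDl.
  have := parameterized_integral_continuous (ltW t1)
    (lbm_integrable (t + 1) lf).
  move=> /(continuous_within_itvP _ t1)[ct c0 _]; split=> // t_gt0.
  by apply: ct; rewrite in_itv/= t_gt0 ltrDl ltr01.
split=> t t0.
  have [ct c0] := cont t t0.
  move: t0; rewrite le_eqVlt => /orP[/eqP <- //|t0].
  by apply: cvg_at_right_filter; exact: ct.
apply/cvg_ex; exists (primitive f t); apply: cvg_at_left_filter.
by have [+ _] := cont t (ltW t0); exact.
Qed.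

Lemma integral_expR_le (R : realType) (lam t : R) : 0 < lam -> 0 <= t ->
  primitive (fun s => expR (lam * s)) t <= expR (lam * t) / lam.
Proof.
move=> l0; rewrite le_eqVlt => /orP[/eqP <-|t0].
  by rewrite set_itv1 Rintegral_set1 divr_ge0 ?expR_ge0// ltW.
pose F (s : R) := lam^-1 * expR (lam * s).
have cE : continuous (fun s : R => expR (lam * s)).
  move=> s; apply: (@continuous_comp _ _ _ ( *%R lam) (@expR R)).
    exact: mulrl_continuous.
  exact: continuous_expR.
have dF (s : R) : is_derive s (1 : R) F (expR (lam * s)).
  have d1 : is_derive s (1 : R) (fun s : R => lam * s) lam.
    by apply: is_derive_eq; exact: mulr1.
  have d2 := is_deriveZ lam^-1 (is_derive1_comp (is_derive_expR (lam * s)) d1).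
  apply: is_derive_eq d2 _.
  by rewrite /GRing.scale/=; field; rewrite lt0r_neq0.
have cF : continuous F.
  by move=> s; apply: cvgM; [exact: cvg_cst | exact: cE].
rewrite /Rintegral (@continuous_FTC2 _ _ F 0 t)//.
- by rewrite -EFinB/= /F mulr0 expR0 mulr1 mulrC gerBl invr_ge0 ltW.
- exact: continuous_subspaceT.
- split.
  + by move=> s _; have [] := dF s.
  + by apply: cvg_at_right_filter; exact: cF.
  + by apply: cvg_at_left_filter; exact: cF.
- by move=> s _; rewrite derive1E; have [_] := dF s.
Qed.

(** Integration in time gains the factor [1 / lam] in the weighted norm. *)
Lemma primitive_close (R : realType) (f g : R -> R) (lam A t : R) :
  lbm f -> lbm g -> 0 < lam -> 0 <= A -> 0 <= t ->
  (forall s, 0 <= s <= t -> `|f s - g s| <= A * expR (lam * s)) ->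
  `|primitive f t - primitive g t| <= A / lam * expR (lam * t).
Proof.
move=> lf lg l0 A0 t0 fg.
have cE : continuous (fun s : R => expR (lam * s)).
  move=> s; apply: (@continuous_comp _ _ _ ( *%R lam) (@expR R)).
    exact: mulrl_continuous.
  exact: continuous_expR.
have iE : (@lebesgue_measure R).-integrable `[0, t]
    (EFin \o (fun s => expR (lam * s))).
  apply: continuous_compact_integrable; first exact: segment_compact.
  exact: continuous_subspaceT.
have mI : measurable (`[0, t] : set R) by exact: measurable_itv.
have iF := lbm_integrable t lf; have iG := lbm_integrable t lg.
have iB : (@lebesgue_measure R).-integrable `[0, t]
    (EFin \o (fun s => f s - g s)).
  exact: (@integrableB _ _ _ (@lebesgue_measure R) _ mI _ _ iF iG).
rewrite -RintegralB//; apply: (le_trans (le_normr_Rintegral _ _)) => //.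
apply: (@le_trans _ _ (primitive (fun s => A * expR (lam * s)) t)).
  apply: le_Rintegral => //.
  - exact: integrable_norm iB.
  - exact: integrableZl iE.
rewrite RintegralZl// -mulrA ler_wpM2l// mulrC.
by rewrite integral_expR_le.
Qed.

(** Balls of row vectors are products of balls of the coordinates. *)
Lemma cadlag_coord (R : realType) (n : nat) (f : R -> 'rV[R]_n) :
  cadlag f <-> forall j, rcll (fun t => f t 0 j).
Proof.
split=> [[fr fl] j|fr].
  split=> t t0.
    apply: (@cvg_comp _ _ _ f (fun M : 'rV[R]_n => M 0 j) _ _ _ (fr t t0)).
    exact: coord_continuous.
  have /cvg_ex[l fsl] := fl t t0; apply/cvg_ex; exists (l 0 j).
  apply: (@cvg_comp _ _ _ f (fun M : 'rV[R]_n => M 0 j) _ _ _ fsl).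
  exact: coord_continuous.
have coord (F : set_system R) (l : 'rV[R]_n) : ProperFilter F ->
    (forall j, f s 0 j @[s --> F] --> l 0 j) -> f s @[s --> F] --> l.
  move=> FF fj; apply/cvg_ballP => e e0.
  have : \forall s \near F, forall j, ball (l 0 j) e (f s 0 j).
    by apply: filter_forall => j; have /cvg_ballP := fj j; exact.
  by apply: filterS => s ls; split=> // i j; rewrite ord1.
split=> t t0; first by apply: coord => j; case: (fr j) => + _; exact.
have ex_l j : exists l : R, f s 0 j @[s --> t^'-] --> l.
  by case: (fr j) => _ /(_ t t0)/cvg_ex.
have [l fl] := choice ex_l.
apply/cvg_ex; exists (\row_j l j); apply: coord => j.
by rewrite mxE.
Qed.

(** * The network equations *)

Section Network.
Variables (R : realType) (J K : nat) (mu : 'I_J -> R) (eta : 'I_K -> R).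
Variables (p : 'M[R]_(J, K)) (q : 'M[R]_(K, J)).
Hypotheses (mu_gt0 : forall j, 0 < mu j) (eta_gt0 : forall k, 0 < eta k).
Hypotheses (p_stoch : stochastic p) (q_stoch : stochastic q).
Variables (xi : R -> 'rV[R]_J) (zeta : R -> 'rV[R]_K).
Hypotheses (xi_cadlag : cadlag xi) (zeta_cadlag : cadlag zeta).
Hypothesis xi0_ge0 : forall j, 0 <= xi 0 0 j.
Implicit Types (y z : 'I_K -> R -> R) (t : R).

(** The path [x_j] before reflection, in units of [mu_j]: then [u_j] itself is
    its regulator. *)
Definition free_path y (j : 'I_J) t : R :=
  (xi t 0 j + \sum_(k < K) q k j * eta k * primitive (y k) t) / mu j.

(** Once each [u_j] is expressed through [y] by reflection, the equation for
    [y] reads [y = feedback y]. *)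
Definition feedback y (k : 'I_K) t : R :=
  zeta t 0 k - eta k * primitive (y k) t
    - \sum_(j < J) p j k * mu j * reg (free_path y j) t.

Lemma free_path_rcll y j : (forall k, lbm (y k)) -> rcll (free_path y j).
Proof.
move=> ly; apply: rcllM; last exact: rcll_cst.
apply: rcllD; first by move/cadlag_coord : xi_cadlag; exact.
by apply: rcll_sum => k; apply: rcllZ; exact: primitive_rcll.
Qed.

Lemma free_path0_ge0 y j : 0 <= free_path y j 0.
Proof.
rewrite divr_ge0 ?(ltW (mu_gt0 j))// big1 ?addr0// => k _.
by rewrite set_itv1 Rintegral_set1 mulr0.
Qed.

Lemma feedback_rcll y k : (forall k, lbm (y k)) -> rcll (feedback y k).
Proof.
move=> ly; apply: rcllB; last first.
  apply: rcll_sum => j; apply: rcllZ.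
  by apply: reg_rcll; [exact: free_path_rcll | exact: free_path0_ge0].
apply: rcllB; first by move/cadlag_coord : zeta_cadlag; exact.
by apply: rcllZ; exact: primitive_rcll.
Qed.

Let p_ge0 j k : 0 <= p j k. Proof. by case: p_stoch. Qed.
Let q_ge0 k j : 0 <= q k j. Proof. by case: q_stoch. Qed.
Let eta_ge0 k : 0 <= eta k. Proof. exact: ltW. Qed.

(** A Lipschitz constant of [feedback] as a function of the integrals of [y]. *)
Let gain (k : 'I_K) : R :=
  eta k + \sum_(j < J) p j k * \sum_(i < K) q i j * eta i.

Let gain_ge0 k : 0 <= gain k.
Proof.
rewrite addr_ge0// sumr_ge0// => j _; rewrite mulr_ge0// sumr_ge0// => i _.
exact: mulr_ge0.
Qed.

(** Integration divides the weighted distance by [rate], which makes up for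
    every [gain k] with a factor 2 to spare.  The summand [1] keeps [rate]
    positive when [K = 0]. *)
Definition rate : R := 2 * (1 + \sum_k gain k).

Lemma rate_gt0 : 0 < rate.
Proof. by rewrite mulr_gt0// ltr_pwDl// sumr_ge0. Qed.

Lemma feedback_contraction y z :
  (forall k, lbm (y k)) -> (forall k, lbm (z k)) ->
  forall T A, 0 <= A -> close rate T A y z ->
  close rate T (A / 2) (feedback y) (feedback z).
Proof.
move=> ly lz T A A0 yz k t /andP[t0 tT].
pose D := A / rate * expR (rate * t).
have D0 : 0 <= D by rewrite mulr_ge0 ?expR_ge0// divr_ge0// ltW ?rate_gt0.
have dprim i s : 0 <= s <= t -> `|primitive (y i) s - primitive (z i) s| <= D.
  move=> /andP[s0 st].
  have H : `|primitive (y i) s - primitive (z i) s| <=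
      A / rate * expR (rate * s).
    apply: primitive_close => //; first exact: rate_gt0.
    move=> r /andP[r0 rs]; apply: yz.
    by rewrite r0 (le_trans rs)// (le_trans st).
  rewrite (le_trans H)// ler_wpM2l ?divr_ge0// ?ler_expR ?ler_wpM2l// ltW//;
    exact: rate_gt0.
have dreg j : `|reg (free_path y j) t - reg (free_path z j) t| <=
    (\sum_(i < K) q i j * eta i) * D / mu j.
  apply: reg_lipschitz.
  - exact/rcll_locally_bounded/free_path_rcll.
  - exact/rcll_locally_bounded/free_path_rcll.
  - rewrite divr_ge0 ?(ltW (mu_gt0 j))// mulr_ge0// sumr_ge0// => i _.
    exact: mulr_ge0.
  - move=> s st; rewrite /free_path -mulrBl normrM ler_pM//.
      rewrite opprD addrACA subrr add0r -sumrB mulr_suml.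
      apply: (le_trans (ler_norm_sum _ _ _)); apply: ler_sum => i _.
      rewrite -mulrBr normrM ger0_norm ?mulr_ge0//.
      by rewrite ler_wpM2l ?mulr_ge0// dprim.
    by rewrite ger0_norm// invr_ge0 ltW.
have fb : `|feedback y k t - feedback z k t| <= gain k * D.
  have -> : feedback y k t - feedback z k t =
      - (eta k * (primitive (y k) t - primitive (z k) t)
      + \sum_(j < J) p j k * mu j *
          (reg (free_path y j) t - reg (free_path z j) t)).
    rewrite /feedback; under [in RHS]eq_bigr do rewrite mulrBr.
    by rewrite sumrB; ring.
  rewrite normrN (le_trans (ler_normD _ _))// /gain mulrDl lerD//.
    by rewrite normrM ger0_norm// ler_wpM2l// dprim// t0 lexx.
  rewrite mulr_suml (le_trans (ler_norm_sum _ _ _))//; apply: ler_sum => j _.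
  have mu0 : 0 <= mu j by exact: ltW.
  rewrite normrM ger0_norm ?mulr_ge0// -!mulrA ler_wpM2l//.
  rewrite (le_trans (ler_wpM2l mu0 (dreg j)))// le_eqVlt; apply/orP; left.
  by apply/eqP; rewrite mulrC divfK// lt0r_neq0.
rewrite (le_trans fb)// /D mulrA ler_wpM2r ?expR_ge0//.
have -> : gain k * (A / rate) = A * (gain k / rate) by ring.
rewrite ler_wpM2l// ler_pdivrMr ?rate_gt0// /rate mulrA mulVf// mul1r.
by rewrite (bigD1 k)//= addrCA lerDl addr_ge0// sumr_ge0.
Qed.

Lemma feedback_lbm y : (forall k, lbm (y k)) -> forall k, lbm (feedback y k).
Proof. by move=> ly k; exact/rcll_lbm/feedback_rcll. Qed.

(** The equation for [x_j], its sign and the complementarity condition say that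
    [u_j] regulates the free path of [y]; this determines [u_j]. *)
Lemma solution_reflection x u (y : R -> 'rV[R]_K) :
  solution mu eta p q xi zeta x u y ->
  [/\ forall j t, 0 <= t ->
        u t 0 j = reg (free_path (fun k s => y s 0 k) j) t,
      forall j t, 0 <= t ->
        x t 0 j = mu j * (free_path (fun k s => y s 0 k) j t +
          reg (free_path (fun k s => y s 0 k) j) t),
      forall k, lbm (fun s => y s 0 k)
    & forall k t, 0 <= t ->
        y t 0 k = feedback (fun k s => y s 0 k) k t].
Proof.
move=> [[/cadlag_coord cx /cadlag_coord cu /cadlag_coord cy]].
move=> [ex ey _ mono comp].
have ly k : lbm (fun s => y s 0 k) by exact: rcll_lbm.
pose F j := free_path (fun k s => y s 0 k) j.
have xE j t : 0 <= t -> x t 0 j = mu j * (F j t + u t 0 j).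
  move=> t0; rewrite (ex j t t0).1 /F /free_path mulrDr; congr (_ + _).
  by rewrite mulrC divfK// lt0r_neq0.
have uE j t : 0 <= t -> u t 0 j = reg (F j) t.
  have [U [UE]] := comp j.
  have mx : measurable_fun (`[0, +oo[ : set R) (fun t => x t 0 j).
    exact: rcll_measurable.
  move=> /(stieltjes_integral_positive U mx).1 null.
  apply: (@reg_unique _ (F j) (fun t => u t 0 j) U).
  - exact: free_path_rcll.
  - exact: free_path0_ge0.
  - by move=> s s0; have := (ex j s s0).2; rewrite xE// pmulr_rge0.
  - exact: (mono j).1.
  - exact: (mono j).2.
  - exact: UE.
  - move: null; congr (_.-negligible _); apply/seteqP.
    by split=> s /= [s0]; rewrite xE// pmulr_rgt0.
split=> //.
- by move=> j t t0; rewrite xE// uE.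
- move=> k t t0; rewrite ey// /feedback; congr (_ - _).
  by apply: eq_bigr => j _; rewrite uE.
Qed.

(** On negative times [reg] vanishes, so it is its own extension to a function
    generating a Stieltjes measure. *)
Lemma regulator_complementarity y j : (forall k, lbm (y k)) ->
  stieltjes_integral_eq (reg (free_path y j))
    (\1_[set t | 0 < mu j * (free_path y j t + reg (free_path y j) t)]) 0%E.
Proof.
move=> ly; set F := free_path y j.
have rF : rcll F by exact: free_path_rcll.
have F0 : 0 <= F 0 by exact: free_path0_ge0.
have bF := rcll_locally_bounded rF.
pose U : cumulative R R := HB.pack_for (cumulative R R) (reg F)
  (isCumulative.Build R _ R (reg F) (reg_nondecreasing bF)
    (fun t => @reg_right_continuous R F t rF F0)).
exists U; split.
  move=> t; rewrite /U/=; have [t0|t0] := leP 0 t; first by [].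
  by rewrite !reg_le0// ltW.
have rx : rcll (fun t => mu j * (F t + reg F t)).
  by apply: rcllZ; apply: rcllD => //; exact: reg_rcll.
apply/(stieltjes_integral_positive U (rcll_measurable rx)).2.
have := @reg_complementarity _ F U rF F0 (fun=> erefl).
congr (_.-negligible _); apply/seteqP.
by split=> s /= [s0]; rewrite pmulr_rgt0.
Qed.

Hypothesis xi_zeta_sum : forall t : R, 0 <= t ->
  \sum_(j < J) xi t 0 j + \sum_(k < K) zeta t 0 k = 0.

(** The mass leaving one group of coordinates enters the other, because the rows
    of [p] and [q] sum to [1]. *)
Lemma balance (a : 'I_K -> R) (b : 'I_J -> R) t : 0 <= t ->
  \sum_j (xi t 0 j + \sum_k q k j * a k + b j) +
  \sum_k (zeta t 0 k - a k - \sum_j p j k * b j) = 0.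
Proof.
move=> t0; have qa : \sum_j \sum_k q k j * a k = \sum_k a k.
  rewrite exchange_big/=; apply: eq_bigr => k _.
  by rewrite -mulr_suml q_stoch.2 mul1r.
have pb : \sum_k \sum_j p j k * b j = \sum_j b j.
  rewrite exchange_big/=; apply: eq_bigr => j _.
  by rewrite -mulr_suml p_stoch.2 mul1r.
rewrite !big_split/= !sumrN qa pb.
by have := xi_zeta_sum t0; lra.
Qed.

Lemma fixed_point_solution y : (forall k, lbm (y k)) ->
  (forall k t, 0 <= t -> y k t = feedback y k t) ->
  solution mu eta p q xi zeta
    (fun t => \row_j (mu j * (free_path y j t + reg (free_path y j) t)))
    (fun t => \row_j reg (free_path y j) t) (fun t => \row_k y k t).
Proof.
move=> ly yE.
have rF j : rcll (free_path y j) by exact: free_path_rcll.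
have F0 j : 0 <= free_path y j 0 by exact: free_path0_ge0.
have bF j := rcll_locally_bounded (rF j).
have prow k t : primitive (fun s => (\row_i y i s : 'rV[R]_K) 0 k) t =
    primitive (y k) t.
  by apply: eq_Rintegral => s _; rewrite mxE.
have xE j t : mu j * (free_path y j t + reg (free_path y j) t) =
    xi t 0 j + \sum_k q k j * (eta k * primitive (y k) t)
    + mu j * reg (free_path y j) t.
  rewrite mulrDr /free_path mulrC divfK ?lt0r_neq0//; congr (_ + _ + _).
  by apply: eq_bigr => k _; rewrite mulrA.
split.
  split; apply/cadlag_coord => j; under eq_fun do rewrite mxE.
  - by apply: rcllZ; apply: rcllD => //; exact: reg_rcll.
  - exact: reg_rcll.
  - apply: (rcll_eq (f := feedback y j)); first by move=> t /yE.
    exact: feedback_rcll.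
split.
- move=> j t t0; rewrite !mxE; split.
    rewrite xE; congr (_ + _ + _).
    by apply: eq_bigr => k _; rewrite prow mulrA.
  rewrite mulr_ge0//; first exact: ltW.
  have := @reg_ge _ (free_path y j) t t (bF j).
  by rewrite t0 lexx => /(_ isT); lra.
- move=> k t t0; rewrite mxE prow yE// /feedback; congr (_ - _).
  by apply: eq_bigr => j _; rewrite mxE.
- move=> t t0; rewrite -[RHS](@balance (fun k => eta k * primitive (y k) t)
    (fun j => mu j * reg (free_path y j) t) t t0).
  congr (_ + _); apply: eq_bigr => i _; rewrite mxE ?xE// yE// /feedback.
  by congr (_ - _); apply: eq_bigr => j _; rewrite mulrA.
- move=> j; split.
    by move=> s t s0 st; rewrite !mxE reg_nondecreasing.
  by rewrite mxE reg_le0.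
- move=> j; under eq_fun do rewrite mxE.
  have -> : [set t | 0 < (\row_i (mu i * (free_path y i t
      + reg (free_path y i) t)) : 'rV[R]_J) 0 j] =
    [set t | 0 < mu j * (free_path y j t + reg (free_path y j) t)].
    by apply/seteqP; split=> t /=; rewrite mxE.
  exact: regulator_complementarity.
Qed.

End Network.

Theorem proposition1 (R : realType) (J K : nat)
    (mu : 'I_J -> R) (eta : 'I_K -> R)
    (p : 'M[R]_(J, K)) (q : 'M[R]_(K, J))
    (mu_gt0 : forall j, 0 < mu j) (eta_gt0 : forall k, 0 < eta k)
    (p_stoch : stochastic p) (q_stoch : stochastic q)
    (xi : R -> 'rV[R]_J) (zeta : R -> 'rV[R]_K)
    (xi_cadlag : cadlag xi) (zeta_cadlag : cadlag zeta)
    (xi_zeta_sum : forall t : R, 0 <= t ->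
       \sum_(j < J) xi t 0 j + \sum_(k < K) zeta t 0 k = 0)
    (xi0_ge0 : forall j, 0 <= xi 0 0 j) :
  exists (x u : R -> 'rV[R]_J) (y : R -> 'rV[R]_K),
    solution mu eta p q xi zeta x u y /\
    forall (x' u' : R -> 'rV[R]_J) (y' : R -> 'rV[R]_K),
      solution mu eta p q xi zeta x' u' y' ->
      [/\ eq_on_halfline x' x, eq_on_halfline u' u & eq_on_halfline y' y].
Proof.
have lbm_fb := feedback_lbm eta p q mu_gt0 xi_cadlag zeta_cadlag xi0_ge0.
have contr := feedback_contraction mu_gt0 eta_gt0 p_stoch q_stoch zeta
  xi_cadlag.
have rate0 := ltW (rate_gt0 eta_gt0 p_stoch q_stoch).
have [y ly yE] := fixed_point_exists rate0 lbm_fb contr.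
exists (fun t => \row_j (mu j * (free_path mu eta q xi y j t +
  reg (free_path mu eta q xi y j) t))).
exists (fun t => \row_j reg (free_path mu eta q xi y j) t).
exists (fun t => \row_k y k t); split; first exact: fixed_point_solution.
move=> x' u' y'.
move=> /(solution_reflection mu_gt0 xi_cadlag xi0_ge0)[u'E x'E ly' y'E].
have y'y := fixed_point_unique rate0 contr ly' ly y'E yE.
have freeE j t : 0 <= t -> free_path mu eta q xi (fun k s => y' s 0 k) j t =
    free_path mu eta q xi y j t.
  move=> t0; rewrite /free_path; congr ((_ + _) / _).
  apply: eq_bigr => k _; congr (_ * _); apply: eq_Rintegral => s.
  by rewrite inE/= in_itv/= => /andP[s0 _]; exact: y'y.
have regE j t : 0 <= t ->
    reg (free_path mu eta q xi (fun k s => y' s 0 k) j) t =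
    reg (free_path mu eta q xi y j) t.
  by move=> t0; apply: eq_reg => s /andP[s0 _]; exact: freeE.
split=> t t0; apply/rowP => i; rewrite mxE.
- by rewrite x'E// freeE// regE.
- by rewrite u'E// regE.
- exact: y'y.
Qed.
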